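(* Let $s\ge 1$ and consider an $s$-stage explicit Runge--Kutta scheme with real coefficients $a_{ik}$, $0\le k<i\le s$ (where $a_{sj}=b_j$ are the weights), whose sub-diagonal elements are non-zero, i.e. $a_{i,i-1}\ne 0$ for all $1\le i\le s$. Then the scheme satisfies the RK-SSP condition if and only if all elements of the strictly lower-triangular part of $A_L$ are positive, i.e. $a_{ik}>0$ for all $0\le k<i\le s$.
   Context: An $s$-stage explicit Runge--Kutta scheme for an ODE system $u'=G(u)$ with time step $\tau$ and coefficients $a_{ik}$ ($0\le k<i\le s$) is $$v_0=u_n,\qquad v_i=u_n+\tau\sum_{j=0}^{i-1}a_{ij}G(v_j)\quad(1\le i\le s),\qquad u_{n+1}=v_s,$$ where the last row is $a_{sj}=b_j$, with $b_j$ the weights of the Butcher tableau. The strictly lower-triangular matrix $A_L$ is the $(s+1)\times(s+1)$ matrix, with rows and columns indexed by $0,\dots,s$, whose entries below the diagonal are $a_{ik}$, $0\le k<i\le s$, all other entries being zero. Shu--Osher form: given numbers $\alpha_{ik}$ ($0\le k<i\le s$) with $\sum_{k=0}^{i-1}\alpha_{ik}=1$ for $1\le i\le s$, the scheme can be rewritten as $$v_0=u_n,\qquad v_i=\sum_{k=0}^{i-1}\bigl(\alpha_{ik}v_k+\tau\beta_{ik}G(v_k)\bigr)\quad(1\le i\le s),\qquad u_{n+1}=v_s,$$ where $$\beta_{ik}=a_{ik}-\sum_{j=k+1}^{i-1}\alpha_{ij}a_{jk},\qquad 0\le k\le i-1 .$$ The scheme satisfies the RK-SSP condition if there exist $\alpha_{ik}$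 such that, with $\beta_{ik}$ given by $\beta_{ik}=a_{ik}-\sum_{j=k+1}^{i-1}\alpha_{ij}a_{jk}$ for $0\le k\le i-1$, $\sum_{k=0}^{i-1}\alpha_{ik}=1$ for $1\le i\le s$, and $\alpha_{ik}\ge 0$, $\beta_{ik}\ge 0$ for all $0\le k<i\le s$, and $\beta_{ik}=0$ whenever $\alpha_{ik}=0$. *)

(* Defs.v *)
From mathcomp Require Import all_boot all_order all_algebra.
From mathcomp Require Import reals.
Set Implicit Arguments.
Unset Strict Implicit.
Unset Printing Implicit Defensive.
Import Order.TTheory GRing.Theory Num.Theory.
Local Open Scope ring_scope.

(* An s-stage explicit Runge-Kutta scheme for u' = G(u), given by its
   coefficients a_ik, 0 <= k < i <= s:
     v_0 = u_n,  v_i = u_n + tau * \sum_(j < i) a_ij G(v_j),  u_(n+1) = v_s.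
   The Butcher weights are the last row, a_sj = b_j.  [A_L] is the
   (s+1) x (s+1) matrix of the a_ik, zero on and above the diagonal. *)
Record explicitRK (R : realType) (s : nat) := ExplicitRK {
  A_L : 'M[R]_s.+1;
  A_L_strict : forall i k : 'I_s.+1, (i <= k)%N -> A_L i k = 0
}.

(* The coefficient beta_ik multiplying tau G(v_k) when the i-th stage is put in
   Shu-Osher form v_i = \sum_(k < i) (alpha_ik v_k + tau beta_ik G(v_k));
   meaningful for k < i.  Only the entries of [alpha] strictly below the
   diagonal are ever used. *)
Definition shu_osher_beta (R : realType) (s : nat) (rk : explicitRK R s)
    (alpha : 'M[R]_s.+1) (i k : 'I_s.+1) : R :=
  A_L rk i k - \sum_(j < s.+1 | (k < j < i)%N) alpha i j * A_L rk j k.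

Definition RK_SSP (R : realType) (s : nat) (rk : explicitRK R s) : Prop :=
  exists alpha : 'M[R]_s.+1,
    [/\ forall i : 'I_s.+1, (0 < i)%N ->
          \sum_(k < s.+1 | (k < i)%N) alpha i k = 1,
        forall i k : 'I_s.+1, (k < i)%N -> 0 <= alpha i k,
        forall i k : 'I_s.+1, (k < i)%N -> 0 <= shu_osher_beta rk alpha i k
      & forall i k : 'I_s.+1, (k < i)%N ->
          alpha i k = 0 -> shu_osher_beta rk alpha i k = 0].

(* Main.v *)
Require Import Defs.
From mathcomp Require Import all_boot all_order all_algebra.
From mathcomp Require Import reals.
Import Order.TTheory GRing.Theory Num.Theory.
Local Open Scope ring_scope.

(** If the scheme is SSP, then [beta_(i,i-1) = a_(i,i-1) <> 0] forces
    [alpha_(i,i-1) > 0], and the identity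
    [a_ik = beta_ik + \sum_(k < j < i) alpha_ij a_jk] propagates positivity down
    the rows, the term [j = i-1] being positive.  Conversely, if all the
    coefficients are positive, take [alpha_ik = eps] for [0 < k < i], so that
    column 0 absorbs the rest of the row sum: since [alpha_i0] does not enter
    any [beta_ik], these are perturbations of size [O(eps)] of the [a_ik]. *)

Lemma RK_SSP_A_L_gt0 (R : realType) (s : nat) (rk : explicitRK R s) :
  (forall i k : 'I_s.+1, nat_of_ord i = k.+1 -> A_L rk i k <> 0) ->
  RK_SSP rk -> forall i k : 'I_s.+1, (k < i)%N -> 0 < A_L rk i k.
Proof.
move=> subdiag_neq0 [alpha [_ alpha_ge0 beta_ge0 beta_eq0]] i.
(* Strong induction on the row [i], with the column [k] left general. *)
have [n] := ubnP (nat_of_ord i); elim: n i => // n IHn i /ltnSE-le_in k lt_ki.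
(* No index lies strictly between [i - 1] and [i], so the correction sum is empty. *)
have beta_subdiag (j : 'I_s.+1) : nat_of_ord i = j.+1 ->
    shu_osher_beta rk alpha i j = A_L rk i j.
  move=> ij; rewrite /shu_osher_beta big_pred0 ?subr0// => l.
  by rewrite ij ltnS; case: ltngtP.
have [ik|neq_ik] := eqVneq (nat_of_ord i) k.+1.
  rewrite lt_def -{2}beta_subdiag// beta_ge0// andbT.
  exact/eqP/subdiag_neq0.
have lt_Ski : (k.+1 < i)%N by rewrite ltn_neqAle eq_sym neq_ik.
have lt_i1s : (i.-1 < s.+1)%N by rewrite (leq_ltn_trans (leq_pred i)).
pose p := Ordinal lt_i1s.
have ip : nat_of_ord i = p.+1 by rewrite /= prednK// (leq_trans _ lt_ki).
have lt_kp : (k < p)%N by rewrite -ltnS -ip.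
have lt_pi : (p < i)%N by rewrite ip.
have alpha_gt0 : 0 < alpha i p.
  rewrite lt_def alpha_ge0// andbT; apply/eqP => /(beta_eq0 _ _ lt_pi).
  by rewrite beta_subdiag//; apply: subdiag_neq0.
have A_gt0 (j : 'I_s.+1) : (k < j < i)%N -> 0 < A_L rk j k.
  by case/andP=> lt_kj lt_ji; apply: IHn => //; apply: leq_trans le_in.
have := beta_ge0 i k lt_ki; rewrite /shu_osher_beta subr_ge0.
apply: lt_le_trans; rewrite (bigD1 p) ?lt_kp ?lt_pi//=.
rewrite ltr_pwDl ?mulr_gt0 ?A_gt0 ?lt_kp ?lt_pi//.
apply: sumr_ge0 => j /andP[kji _]; have /andP[_ lt_ji] := kji.
by rewrite mulr_ge0 ?alpha_ge0// ltW ?A_gt0.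
Qed.

Lemma A_L_gt0_RK_SSP (R : realType) (s : nat) (rk : explicitRK R s) :
  (forall i k : 'I_s.+1, (k < i)%N -> 0 < A_L rk i k) -> RK_SSP rk.
Proof.
move=> A_gt0.
have A_ge0 (i k : 'I_s.+1) : 0 <= A_L rk i k.
  by case: (ltnP k i) => [/A_gt0/ltW|/A_L_strict->].
(* Capping the minimum at 1 later keeps [1 - eps * i] nonnegative in column 0. *)
pose m := \big[Order.min/1]_(x : 'I_s.+1 * 'I_s.+1 | (x.2 < x.1)%N)
            A_L rk x.1 x.2.
have m_gt0 : 0 < m by apply: lt_bigmin => // x; apply: A_gt0.
have m_le1 : m <= 1 by apply: bigmin_le_id.
have m_leA (i k : 'I_s.+1) : (k < i)%N -> m <= A_L rk i k.
  by move=> ki; apply: (@bigmin_le_cond _ _ _ _ (i, k)).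
pose T := \sum_k \sum_j A_L rk j k.
have col_leT k : \sum_j A_L rk j k <= T.
  rewrite [leRHS](bigD1 k)//= lerDl sumr_ge0// => l _; exact: sumr_ge0.
have T_ge0 : 0 <= T by apply: sumr_ge0 => k _; apply: sumr_ge0.
(* [d] dominates both the row indices, for the sign of [alpha i 0], and the column sums of [A_L],
   for the sign of the betas; one [eps] then serves both bounds. *)
pose d := s.+1%:R + T.
have d_gt0 : 0 < d by rewrite ltr_pwDl ?ltr0Sn.
pose eps := m / d.
have eps_gt0 : 0 < eps by rewrite divr_gt0.
have eps_le x : x <= d -> eps * x <= m.
  by move=> xd; rewrite mulrAC ler_pdivrMr// ler_pM2l.
(* Row [i] has [i] entries left of the diagonal, each containing [eps]; the extra term in column 0
   brings their sum to 1. *)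
pose alpha : 'M[R]_s.+1 :=
  \matrix_(i, k) (eps + if k == ord0 then 1 - eps * (i : nat)%:R else 0).
have alpha_gt0 i k : 0 < alpha i k.
  rewrite mxE ltr_pwDl//; case: ifP => // _.
  rewrite subr_ge0 (le_trans _ m_le1)// eps_le//.
  by rewrite (@le_trans _ _ s.+1%:R) ?lerDl// ler_nat ltnW.
exists alpha; split=> [i i_gt0|i k _|i k lt_ki|i k _ a0].
- under eq_bigr do rewrite mxE.
  rewrite big_split/= [X in _ + X](bigD1 ord0)//= [X in _ + (_ + X)]big1 => [|k /andP[_ /negPf->]//].
  rewrite (big_ord_narrow (ltnW (ltn_ord i))).
  by rewrite sumr_const card_ord addr0 mulr_natr addrC subrK.
- exact: ltW.
- rewrite /shu_osher_beta subr_ge0.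
  (* Here [k < j] forces [j] to be nonzero, so column 0 of [alpha] never occurs. *)
  have -> : \sum_(j < s.+1 | (k < j < i)%N) alpha i j * A_L rk j k =
            eps * \sum_(j < s.+1 | (k < j < i)%N) A_L rk j k.
    rewrite mulr_sumr; apply: eq_bigr => j /andP[kj _].
    by rewrite mxE -val_eqE/= -[_ == _]negbK -lt0n (leq_ltn_trans _ kj)//= addr0.
  apply: le_trans (m_leA i k lt_ki); apply: eps_le.
  apply: (@le_trans _ _ T); last by rewrite lerDr ler0n.
  apply: le_trans (col_leT k).
  by rewrite big_mkcond ler_sum// => j _; case: ifP.
(* Vacuous, as every entry of [alpha] is positive. *)
- by have := alpha_gt0 i k; rewrite a0 ltxx.
Qed.

Theorem theorem3 (R : realType) (s : nat) (rk : explicitRK R s)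
    (s_ge1 : (1 <= s)%N)
    (subdiag_neq0 : forall i k : 'I_s.+1,
       nat_of_ord i = (nat_of_ord k).+1 -> A_L rk i k <> 0) :
  RK_SSP rk <->
  (forall i k : 'I_s.+1, (k < i)%N -> 0 < A_L rk i k).
Proof.
by split; [apply: RK_SSP_A_L_gt0|apply: A_L_gt0_RK_SSP].
Qed.
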